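(* Let $X$ be a real locally convex topological vector space and let $f\colon X\to(-\infty,\infty]$ be a convex function. (a) We have the inclusion $$\operatorname{qri}\big(\operatorname{epi}(f)\big)\supset\big\{(x,\lambda)\in X\times\mathbb{R}\;\big|\;x\in\operatorname{qri}\big(\operatorname{dom}(f)\big),\;\lambda>f(x)\big\}.$$ (b) If in addition $\operatorname{epi}(f)$ is quasi-regular, then $\operatorname{dom}(f)$ is quasi-regular and $$\operatorname{qri}\big(\operatorname{epi}(f)\big)=\big\{(x,\lambda)\in X\times\mathbb{R}\;\big|\;x\in\operatorname{qri}\big(\operatorname{dom}(f)\big),\;\lambda>f(x)\big\}.$$
   Context: For a nonempty subset $A$ of a real locally convex topological vector space $Z$, $\operatorname{cone}(A):=\{ta\mid t\ge 0,\ a\in A\}$ and $\overline{\operatorname{cone}}(A)$ is its closure. For a nonempty convex set $\Omega\subset Z$, the intrinsic relative interior is $\operatorname{iri}(\Omega):=\{x\in\Omega\mid \operatorname{cone}(\Omega-x)\text{ is a linear subspace of }Z\}$ and the quasi-relative interior is $\operatorname{qri}(\Omega):=\{x\in\Omega\mid \overline{\operatorname{cone}}(\Omega-x)\text{ is a linear subspace of }Z\}$; by convention $\operatorname{iri}(\emptyset)=\operatorname{qri}(\emptyset)=\emptyset$. A convex set $\Omega$ is called quasi-regular if $\operatorname{qri}(\Omega)=\operatorname{iri}(\Omega)$. For $f\colon X\to(-\infty,\infty]$, $\operatorname{dom}(f):=\{x\in X\mid f(x)<\infty\}$ and $\operatorname{epi}(f):=\{(x,\alpha)\in X\times\mathbb{R}\mid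 \alpha\ge f(x)\}$; $f$ is convex if $\operatorname{epi}(f)$ is a convex set. *)

(* Defs.v *)
From HB Require Import structures.
From mathcomp Require Import all_boot all_order all_algebra.
From mathcomp Require Import all_classical all_reals all_analysis.

Set Implicit Arguments.
Unset Strict Implicit.
Unset Printing Implicit Defensive.

Import Order.TTheory GRing.Theory Num.Theory.
Import numFieldNormedType.Exports.

Local Open Scope classical_set_scope.
Local Open Scope ring_scope.

Definition cone (R : realType) (Z : lmodType R) (A : set Z) : set Z :=
  [set t *: a | t in [set t : R | 0 <= t] & a in A].

Definition set_shift (R : realType) (Z : lmodType R) (A : set Z) (x : Z)
  : set Z := [set a - x | a in A].

Definition linear_subspace (R : realType) (Z : lmodType R) (V : set Z) : Prop :=
  submod_closed (mem V).

(* The requirement [A x] makes [iri set0] and [qri set0] empty.  Both are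
   defined for every set, but are meant for convex ones. *)
Definition iri (R : realType) (Z : lmodType R) (A : set Z) : set Z :=
  [set x | A x /\ linear_subspace (cone (set_shift A x))].

Definition qri (R : realType) (Z : tvsType R) (A : set Z) : set Z :=
  [set x | A x /\ linear_subspace (closure (cone (set_shift A x)))].

Definition quasi_regular (R : realType) (Z : tvsType R) (A : set Z) : Prop :=
  convex_set A /\ qri A = iri A.

Definition dom (R : realType) (X : Type) (f : X -> \bar R) : set X :=
  [set x | (f x < +oo)%E].

(* [R^o] rather than [R], so that the product is a locally convex space
   over [R]. *)
Definition epi (R : realType) (X : tvsType R) (f : X -> \bar R)
  : set (X * R^o)%type := [set p | (f p.1 <= (p.2 : R)%:E)%E].

Definition convex_efun (R : realType) (X : tvsType R) (f : X -> \bar R) : Prop :=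
  convex_set (epi f).

(* Main.v *)
Require Import Defs.
From HB Require Import structures.
From mathcomp Require Import all_boot all_order all_algebra.
From mathcomp Require Import all_classical all_reals all_analysis.
From mathcomp Require Import ring lra.

(**
If [f x < lambda], then [(x, lambda)] is vertically interior to the epigraph:
sliding from [(x, lambda)] towards any [(a, f a)] leaves, by convexity, room to
move up and down, so that
[cone (epi f - (x, lambda)) = cone (dom f - x) `*` setT].
Taking closures, [(x, lambda)] is in the (quasi-)relative interior of [epi f]
iff [x] is in that of [dom f].  Moreover an intrinsic relative interior point
[(x, lambda)] of [epi f] always satisfies [f x < lambda], since the upward
direction [(0, 1)], hence also [(0, -1)], belongs to the cone.
*)

Import Order.TTheory GRing.Theory Num.Theory.
Import numFieldNormedType.Exports.

Local Open Scope classical_set_scope.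
Local Open Scope ring_scope.

Lemma linear_subspaceP (R : realType) (Z : lmodType R) (V : set Z) :
  linear_subspace V <->
  V 0 /\ forall (a : R) u v, V u -> V v -> V (a *: u + v).
Proof.
split=> -[V0 VD]; split.
- by move: V0; rewrite inE.
- by move=> a u v Vu Vv; apply: set_mem; apply: (VD a u v); rewrite inE.
- by rewrite inE.
- by move=> a u v /set_mem Vu /set_mem Vv; rewrite inE; exact: VD.
Qed.

Lemma linear_subspaceN (R : realType) (Z : lmodType R) (V : set Z) (u : Z) :
  linear_subspace V -> V u -> V (- u).
Proof.
move=> /linear_subspaceP[V0 VD] Vu.
by rewrite -scaleN1r -[_ *: u]addr0; exact: VD.
Qed.

(** Used to discard the vertical factor from the cone of the epigraph. *)
Lemma linear_subspaceXT (R : realType) (Z W : lmodType R) (V : set Z) :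
  linear_subspace (V `*` [set: W]) <-> linear_subspace V.
Proof.
split=> /linear_subspaceP[V0 VD]; apply/linear_subspaceP; split.
- by case: V0.
- by move=> a u v Vu Vv; case: (VD a (u, 0) (v, 0)).
- by [].
- by move=> a [u u'] [v v'] [/= Vu _] [/= Vv _]; split => //=; exact: VD.
Qed.

(** By continuity of the operations, a neighbourhood of [a *: u + v] pulls back to neighbourhoods of
    [u] and [v], both of which meet [V]; the scalar [a] itself is kept fixed. *)
Lemma linear_subspace_closure (R : realType) (Z : tvsType R) (V : set Z) :
  linear_subspace V -> linear_subspace (closure V).
Proof.
move=> /linear_subspaceP[V0 VD]; apply/linear_subspaceP.
split=> [|a u v clu clv W]; first exact: subset_closure.
move=> nW.
have [[/= A B] [nA nB] AB] := @add_continuous Z (a *: u, v) _ nW.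
have [[/= K L] [nK nL] KL] := @scale_continuous R Z (a, u) _ nA.
have [u' [Vu' Lu']] := clu _ nL.
have [v' [Vv' Bv']] := clv _ nB.
exists (a *: u' + v'); split; first exact: VD.
apply: (AB (a *: u', v')); split=> //=.
by apply: (KL (a, u')); split=> //=; exact: nbhs_singleton nK.
Qed.

Lemma closureX (S T : topologicalType) (A : set S) (B : set T) :
  closure (A `*` B) = closure A `*` closure B.
Proof.
apply/seteqP; split=> [[x y] cl|[x y] [/= clA clB] W [[/= U V] [nU nV] UV]].
  split=> /= [U nU|U nU].
    have [|z [[Az _] [Uz _]]] := cl (U `*` setT); last by exists z.1.
    by exists (U, setT) => //; split=> //; exact: filterT.
  have [|z [[_ Bz] [_ Uz]]] := cl (setT `*` U); last by exists z.2.
  by exists (setT, U) => //; split=> //; exact: filterT.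
have [a [Aa Ua]] := clA _ nU.
have [b [Bb Vb]] := clB _ nV.
by exists (a, b); split; [split|exact: UV].
Qed.

Section Epigraph.
Context (R : realType) (X : tvsType R) (f : X -> \bar R).
Hypothesis f_gtNy : forall x : X, (-oo < f x)%E.
Hypothesis f_convex : convex_efun f.

Lemma dom_fin (x : X) : dom f x -> f x = (fine (f x))%:E.
Proof. by move=> fx; rewrite fineK// fin_real// f_gtNy. Qed.

(** Real upper bounds [a] and [b] keep the convex combination free of extended-real arithmetic. *)
Lemma epi_convex (x y : X) (a b k : R) : 0 <= k -> k <= 1 ->
  (f x <= a%:E)%E -> (f y <= b%:E)%E ->
  (f (k *: x + (1 - k) *: y)%R <= (k * a + (1 - k) * b)%R%:E)%E.
Proof.
move=> k0 k1 fx fy.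
have := @f_convex (x, a : R^o) (y, b : R^o) (Itv01 k0 k1).
by rewrite !inE; apply.
Qed.

Lemma dom_convex : convex_set (dom f).
Proof.
move=> x y k; rewrite !inE => /dom_fin fx /dom_fin fy.
apply: (@le_lt_trans _ _ (k%:num * fine (f x) + (1 - k%:num) * fine (f y))%:E).
  by apply: epi_convex; rewrite -?fx -?fy.
exact: ltry.
Qed.

Lemma cone_shift_epi (x : X) (l : R) : (f x < l%:E)%E ->
  cone (set_shift (epi f) (x, l : R^o)) =
  cone (set_shift (dom f) x) `*` [set: R^o].
Proof.
move=> fxl; have fx := dom_fin _ (lt_trans fxl (ltry l)).
apply/seteqP; split=> [_ [t t0 [_ [[y m] fy <-] <-]]|].
  split=> //=; exists t => //; exists (y - x) => //; exists y => //.
  exact: le_lt_trans fy (ltry _).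
move=> [v s] [[t t0 [_ [a fa <-] /= <-] _]].
have {}fa := dom_fin _ fa.
set p := fine (f x) in fx; set q := fine (f a) in fa.
have pl : 0 < l - p by rewrite subr_gt0 -lte_fin -fx.
set e := t * (q - p) - s.
(* The scale [T] is large enough for [(x + t (a - x) / T, l + s / T)] to lie
   above the chord joining [(x, p)] and [(a, q)]. *)
pose T := 1 + t + `|e| / (l - p).
have r0 : 0 <= `|e| / (l - p) by rewrite divr_ge0// ltW.
(* The summand [1 + t] makes [T] positive and [t / T] a convex weight; the summand with [e]
   compensates the excess of the chord's rise over [s]. *)
have T0 : 0 < T by rewrite /T; move: t0 r0 => /=; lra.
have tT : t / T <= 1 by rewrite ler_pdivrMr// mul1r /T; lra.
have tT0 : 0 <= t / T by rewrite divr_ge0// ltW.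
exists T; first exact: ltW.
exists (x + (t / T) *: (a - x) - x, (l + s / T - l : R^o)); last first.
  congr pair.
    by rewrite addrAC subrr add0r scalerA mulrCA divff ?gt_eqF// mulr1.
  have -> : l + s / T - l = s / T by rewrite addrAC subrr add0r.
  by rewrite /= /GRing.scale/= mulrCA divff ?gt_eqF// mulr1.
exists (x + (t / T) *: (a - x), (l + s / T : R^o)) => //=.
rewrite /epi/=.
have -> : x + (t / T) *: (a - x) = (t / T) *: a + (1 - t / T) *: x.
  by rewrite scalerBl scalerBr scale1r addrCA.
apply: le_trans (@epi_convex a x q p (t / T) tT0 tT _ _) _; rewrite -?fa -?fx//.
rewrite lee_fin -subr_ge0.
(* This gap above the chord is nonnegative, since [T * (l - p)] equals [(1 + t) * (l - p) + |e|]. *)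
have -> : l + s / T - (t / T * q + (1 - t / T) * p) = (T * (l - p) - e) / T.
  by rewrite /e; field; rewrite gt_eqF.
rewrite divr_ge0 ?(ltW T0)// subr_ge0.
rewrite /T mulrDl divfK ?gt_eqF// (le_trans (ler_norm e))// lerDr.
by rewrite mulr_ge0 ?(ltW pl)// addr_ge0.
Qed.

Lemma qri_epi (x : X) (l : R) : (f x < l%:E)%E ->
  qri (epi f) (x, l : R^o) <-> qri (dom f) x.
Proof.
move=> fxl; rewrite /qri/= cone_shift_epi// closureX closureT linear_subspaceXT.
by split=> -[_ ?]; split=> //; [exact: lt_trans fxl (ltry l)|exact: ltW].
Qed.

Lemma iri_epi (x : X) (l : R) : (f x < l%:E)%E ->
  iri (epi f) (x, l : R^o) <-> iri (dom f) x.
Proof.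
move=> fxl; rewrite /iri/= cone_shift_epi// linear_subspaceXT.
by split=> -[_ ?]; split=> //; [exact: lt_trans fxl (ltry l)|exact: ltW].
Qed.

Lemma iri_epi_lt (x : X) (l : R) : iri (epi f) (x, l : R^o) -> (f x < l%:E)%E.
Proof.
move=> [fxl Dlin].
have D01 : cone (set_shift (epi f) (x, l : R^o)) (0, 1 : R^o).
  exists 1 => /=; first exact: ler01.
  exists (0, 1 : R^o); last by rewrite scale1r.
  exists (x, l + 1 : R^o); first by apply: le_trans fxl _; rewrite lee_fin lerDl.
  by congr pair; rewrite ?subrr// addrAC subrr add0r.
(* Write [(0, -1)] as [t *: (y - x, m - l)] with [(y, m)] in the epigraph. The second coordinate
   excludes [t = 0], so [y = x] and [m < l], whence [f x <= m < l]. *)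
have [t /= t0 [_ [[y m] fym <-] [/eqP tyx tml]]] := linear_subspaceN _ _ _ _ Dlin D01.
have tml1 : t * (m - l) = - 1 by [].
have tgt0 : 0 < t.
  by rewrite lt_neqAle t0 andbT; apply/eqP => t00; move: tml1; rewrite -t00; lra.
move: tyx; rewrite oppr0 scaler_eq0 gt_eqF//= subr_eq0 => /eqP yx.
rewrite -yx; apply: le_lt_trans fym _; rewrite lte_fin/= -subr_lt0.
by rewrite -(pmulr_rlt0 _ tgt0) tml1 ltrN10.
Qed.

End Epigraph.

Lemma iri_qri (R : realType) (Z : tvsType R) (A : set Z) : iri A `<=` qri A.
Proof. by move=> x [Ax Alin]; split=> //; exact: linear_subspace_closure. Qed.

Theorem theorem5p6 (R : realType) (X : tvsType R) (f : X -> \bar R)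
    (f_gtNy : forall x : X, (-oo < f x)%E) (f_convex : convex_efun f) :
  [set p : X * R^o | qri (dom f) p.1 /\ (f p.1 < (p.2 : R)%:E)%E]
    `<=` qri (epi f)
  /\
  (quasi_regular (epi f) ->
     quasi_regular (dom f) /\
     qri (epi f) =
       [set p : X * R^o | qri (dom f) p.1 /\ (f p.1 < (p.2 : R)%:E)%E]).
Proof.
have qri_sub : [set p : X * R^o | qri (dom f) p.1 /\ (f p.1 < (p.2 : R)%:E)%E]
    `<=` qri (epi f) by move=> [x l] [/= qx fxl]; exact/qri_epi.
split=> // -[_ qri_iri]; split; last first.
  apply/seteqP; split=> // -[x l] qxl.
  (* Quasi-regularity supplies the intrinsic relative interior point that strictness requires. *)
  have fxl : (f x < (l : R)%:E)%E by apply: iri_epi_lt; rewrite -qri_iri.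
  by split=> //=; apply/(@qri_epi _ _ _ f_gtNy f_convex x l).
split; first exact: dom_convex.
apply/seteqP; split; last exact: iri_qri.
move=> x qx; have fx := dom_fin _ _ _ f_gtNy _ qx.1.
(* Lift [x] to height [f x + 1], strictly above the graph: there [qri] and [iri] of the epigraph
   agree, and both project back to the domain. *)
have fxl : (f x < (fine (f x) + 1)%R%:E)%E by rewrite [ltLHS]fx lte_fin ltrDl.
apply/(iri_epi _ _ _ f_gtNy f_convex _ _ fxl); rewrite -qri_iri.
exact/qri_epi.
Qed.
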